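(* The coefficient $\mathrm{cr}''$ is not determined by the six signed Pl\''ucker determinants $$(\Delta_{12},\Delta_{13},\Delta_{14},\Delta_{23},\Delta_{24},\Delta_{34})$$ of the normalized primitive lifts. That is, there is no function $F$ on $\mathbb Z^6$ such that $\mathrm{cr}''(x_1,x_2;x_3,x_4)=F(\Delta_{12},\Delta_{13},\Delta_{14},\Delta_{23},\Delta_{24},\Delta_{34})$ for all ordered quadruples $(x_1,x_2,x_3,x_4)$ of pairwise distinct rational points. In particular, there is no formula for $\mathrm{cr}''$ involving only these six integers.
   Context: **Normalized lifts.** For $x_i=a_i/b_i\in\mathbb Q$ with $a_i,b_i\in\mathbb Z$, $\gcd(a_i,b_i)=1$, $b_i>0$, the normalized primitive lift is $\binom{a_i}{b_i}$ (and $\binom10$ for $\infty$); $\Delta_{ij}=a_ib_j-a_jb_i$. **$q$-rationals.** $[\,\cdot\,]_q:\mathbb P^1(\mathbb Q)=\mathbb Q\cup\{\infty\}\to\mathbb P^1(\mathbb Q(q))$ is the unique map with $[0]_q=0$, $[x+1]_q=q[x]_q+1$ and $[-1/x]_q=-1/(q[x]_q)$ for all $x$ (usual conventions for $\infty$; in particular $[\infty]_q=\infty$). For finite $x$, $[x]_q$ is a rational function of $q$, regular at $q=1$ with $[x]_1=x$. **Cross-ratios.** For pairwise distinct points of $\mathbb P^1(\mathbb K)$ with nonzero lifts $X_i\in\mathbb K^2$ and $D_{ij}=\det(X_i,X_j)$, $\mathrm{cr}(x_1,x_2;x_3,x_4)=\frac{D_{13}D_{24}}{D_{14}D_{23}}$.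 For pairwise distinct $x_i\in\mathbb P^1(\mathbb Q)$, $\mathrm{cr}_q(x_1,x_2;x_3,x_4)=\mathrm{cr}([x_1]_q,[x_2]_q;[x_3]_q,[x_4]_q)\in\mathbb Q(q)$. **Taylor coefficients.** With $q=e^h$, $\mathrm{cr}_{e^h}=\mathrm{cr}+\mathrm{cr}'h+\frac{\mathrm{cr}''}{2}h^2+\cdots$ is the Taylor expansion at $h=0$. *)

(* Defs.v *)
From HB Require Import structures.
From mathcomp Require Import all_boot all_order all_algebra.
From mathcomp Require Import all_classical all_reals all_analysis.
From mathcomp Require Import ring lra.

Set Implicit Arguments.
Unset Strict Implicit.
Unset Printing Implicit Defensive.

Import Order.TTheory GRing.Theory Num.Theory.
Import numFieldNormedType.Exports.

Local Open Scope ring_scope.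

(* The projective line over a field K: [Some x] is the finite point x and
   [None] is the point at infinity. *)
Notation P1 := option (only parsing).

Section ProjectiveLine.
Variable K : fieldType.

(* x |-> a x + b, for a != 0, extended by oo |-> oo *)
Definition p1_affine (a b : K) (x : P1 K) : P1 K :=
  omap (fun t => a * t + b) x.

(* x |-> -1 / (c x), for c != 0, extended by 0 |-> oo and oo |-> 0 *)
Definition p1_neginv (c : K) (x : P1 K) : P1 K :=
  match x with
  | Some t => if t == 0 then None else Some (- (c * t)^-1)
  | None => Some 0
  end.

Definition p1_lift (x : P1 K) : K * K :=
  match x with Some t => (t, 1) | None => (1, 0) end.

Definition det2 (X Y : K * K) : K := X.1 * Y.2 - Y.1 * X.2.

Definition cross_ratio (x1 x2 x3 x4 : P1 K) : K :=
  let D x y := det2 (p1_lift x) (p1_lift y) in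
  (D x1 x3 * D x2 x4) / (D x1 x4 * D x2 x3).

Definition is_lift (X : K * K) (x : P1 K) : bool :=
  (X != (0, 0)) && (x == if X.2 == 0 then None else Some (X.1 / X.2)).

Lemma is_liftP X x : is_lift X x ->
  exists2 l : K, l != 0 & X = (l * (p1_lift x).1, l * (p1_lift x).2).
Proof.
case: X => a b /andP[/= X0 /eqP->]; case: (eqVneq b 0) X0 => [->|b0] X0.
  exists a; last by rewrite /= mulr1 mulr0.
  by apply: contraNneq X0 => ->.
by exists b; rewrite //= mulr1 [b * _]mulrC divfK.
Qed.

(* The cross-ratio does not depend on the choice of the nonzero lifts. *)
Lemma cross_ratio_lift X1 X2 X3 X4 x1 x2 x3 x4 :
    is_lift X1 x1 -> is_lift X2 x2 -> is_lift X3 x3 -> is_lift X4 x4 ->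
  cross_ratio x1 x2 x3 x4 =
    (det2 X1 X3 * det2 X2 X4) / (det2 X1 X4 * det2 X2 X3).
Proof.
move=> /is_liftP[l1 n1 ->] /is_liftP[l2 n2 ->].
move=> /is_liftP[l3 n3 ->] /is_liftP[l4 n4 ->].
rewrite /cross_ratio; set Y1 := p1_lift x1; set Y2 := p1_lift x2.
set Y3 := p1_lift x3; set Y4 := p1_lift x4.
have detZ a b X Y : det2 (a * X.1, a * X.2) (b * Y.1, b * Y.2)
    = (a * b) * det2 X Y :> K by rewrite /det2 /=; ring.
rewrite !detZ.
have -> : l1 * l3 * det2 Y1 Y3 * (l2 * l4 * det2 Y2 Y4)
  = (l1 * l2 * l3 * l4) * (det2 Y1 Y3 * det2 Y2 Y4) by ring.
have -> : l1 * l4 * det2 Y1 Y4 * (l2 * l3 * det2 Y2 Y3)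
  = (l1 * l2 * l3 * l4) * (det2 Y1 Y4 * det2 Y2 Y3) by ring.
by rewrite -[RHS]mulf_div divff ?mul1r // !mulf_neq0.
Qed.

End ProjectiveLine.

(* The normalized primitive lift; [numq] and [denq] are coprime, 0 < denq. *)
Definition prim_lift (x : P1 rat) : int * int :=
  match x with Some t => (numq t, denq t) | None => (1, 0) end.

Definition Delta (x y : P1 rat) : int :=
  (prim_lift x).1 * (prim_lift y).2 - (prim_lift y).1 * (prim_lift x).2.

Notation Qq := {fraction {poly rat}}.

Local Notation "p %:F" := (@FracField.tofrac _ p).

Definition qvar : Qq := 'X%:F.

Definition is_q_rational (f : P1 rat -> P1 Qq) : Prop :=
  [/\ f (Some 0) = Some 0,
      forall x, f (p1_affine 1 1 x) = p1_affine qvar 1 (f x)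
    & forall x, f (p1_neginv 1 x) = p1_neginv qvar (f x)].

Section Construction.
Variables (K : fieldType) (q : K).
Hypotheses (q0 : q != 0) (q1 : q - 1 != 0).

Local Notation S := (p1_neginv q).
Local Notation T := (p1_affine q 1).

(* the n-th iterate of T, for n : int *)
Let Tn (n : int) := p1_affine (q ^ n) ((q ^ n - 1) / (q - 1)).

Let SK : involutive S.
Proof.
move=> [t|] /=; last by rewrite eqxx.
case: eqVneq => [->//|t0] /=.
rewrite oppr_eq0 invr_eq0 mulf_eq0 (negPf q0) (negPf t0) /=.
by rewrite mulrN invrN opprK invfM invrK mulKf.
Qed.

Let braid x : T (S (T (S (T x)))) = S x.
Proof.
case: x => [t|] /=; last by rewrite mulr0 add0r oner_eq0 /= mulr1 mulrN divff // addNr.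
case: eqVneq => [h|h] /=.
  have -> : t = - q^-1.
    by apply: (mulfI q0); rewrite mulrN divff //; apply/eqP; rewrite -addr_eq0 h.
  rewrite mulr0 add0r oppr_eq0 invr_eq0 (negPf q0).
  by rewrite mulrN divff // invrN invr1 opprK.
have -> : q * (- (q * (q * t + 1))^-1) + 1 = q * t / (q * t + 1).
  by field; rewrite q0 h.
case: (eqVneq t 0) => [->|t0]; first by rewrite mulr0 mul0r eqxx.
rewrite mulf_eq0 invr_eq0 (negPf h) mulf_eq0 (negPf q0) (negPf t0) /=.
by congr Some; field; rewrite q0 h t0.
Qed.

Let TnS n x : Tn (n + 1) x = T (Tn n x).
Proof.
case: x => [t|] //=; congr Some; rewrite expfzDr // expr1z.
by field.
Qed.

Let Tn0 x : Tn 0 x = x.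
Proof. by case: x => [t|] //=; rewrite expr0z subrr mul0r addr0 mul1r. Qed.

Let Tn1 x : Tn 1 x = T x.
Proof. by rewrite -[1]add0r TnS Tn0. Qed.

Let T_inj : injective T.
Proof.
move=> [t|] [u|] //= [] /eqP; rewrite (inj_eq (addIr _)) => /eqP.
by move/(mulfI q0) ->.
Qed.

Let cfrac_next (x : rat) : rat := ((Num.ceil x)%:~R - x)^-1.

(* If x is not an integer then x = c - 1/y with c = ceil x and y = cfrac_next x,
   whose denominator is smaller, so that [x]_q = T^c (S [y]_q). The fuel n is
   sufficient as soon as the denominator of x is at most n. *)
Fixpoint qrat_rec (n : nat) (x : rat) : P1 K :=
  let c := Num.ceil x in
  if x == c%:~R then Tn c (Some 0) else
  if n is m.+1 then Tn c (S (qrat_rec m (cfrac_next x))) else None.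

Definition qrat_fun (x : P1 rat) : P1 K :=
  if x is Some t then qrat_rec `|denq t|%N t else None.

Let denq_next x : x != (Num.ceil x)%:~R ->
  (`|denq (cfrac_next x)| < `|denq x|)%N.
Proof.
move=> xc; set c := Num.ceil x.
have /andP[lo hi] := ceil_itv x.
have y0 : 0 < c%:~R - x by rewrite subr_gt0 lt_neqAle xc.
have y1 : c%:~R - x < 1 by move: lo; rewrite intrB -/c; lra.
set r : int := c * denq x - numq x.
have dx0 : (denq x)%:~R != 0 :> rat by rewrite intr_eq0.
have dxp : 0 < (denq x)%:~R :> rat by rewrite ltr0z.
have rE : (r%:~R : rat) = (c%:~R - x) * (denq x)%:~R.
  by rewrite /r intrB intrM mulrBl -numqE.
have r0 : 0 < r by rewrite -(ltr0z rat) rE mulr_gt0.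
have r1 : r < denq x by rewrite -(ltr_int rat) rE gtr_pMl.
have yE : cfrac_next x * r%:~R = (denq x)%:~R.
  by rewrite rE /cfrac_next mulrA mulVf ?mul1r // lt0r_neq0.
set y := cfrac_next x in yE *.
have ydE : numq y * r = denq x * denq y.
  by apply: (@intr_inj rat); rewrite !intrM numqE -yE; ring.
have : (denq y %| r)%Z.
  rewrite -(@Gauss_dvdzr _ (numq y)) ?ydE ?dvdz_mull //.
  by rewrite /coprimez /gcdz gcdnC; have := coprime_num_den y; rewrite /coprime => /eqP ->.
move=> /dvdn_leq h.
apply: leq_ltn_trans (h _) _; first by rewrite absz_gt0 lt0r_neq0.
by rewrite -ltz_nat !gez0_abs // ltW.
Qed.

Let qrat_recE n m x : (`|denq x| <= n)%N -> (`|denq x| <= m)%N ->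
  qrat_rec n x = qrat_rec m x.
Proof.
elim: n m x => [|n IHn] m x.
  by rewrite leqn0 absz_eq0 denq_eq0.
case: m => [|m]; first by rewrite [(_ <= 0)%N]leqn0 absz_eq0 denq_eq0.
move=> hn hm /=; case: eqVneq => // xc.
by congr (Tn _ (S _)); apply: IHn; rewrite -ltnS; apply: leq_trans (denq_next xc) _.
Qed.

Let g (x : rat) := qrat_fun (Some x).

Let gz (n : int) : g n%:~R = Tn n (Some 0).
Proof.
by rewrite /g /= denq_int /= intrKceil eqxx.
Qed.

Let gE x : x != (Num.ceil x)%:~R -> g x = Tn (Num.ceil x) (S (g (cfrac_next x))).
Proof.
move=> xc; rewrite /g /=; have := denq_next xc.
case E: `|denq x|%N => [|m] // h /=; rewrite (negPf xc).
by congr (Tn _ (S _)); apply: qrat_recE.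
Qed.

Let gD1 x : g (x + 1) = T (g x).
Proof.
have cD : Num.ceil (x + 1) = Num.ceil x + 1.
  by rewrite ceilDrz ?ceil1 // rpred1.
case: (eqVneq x (Num.ceil x)%:~R) => [xc|xc].
  by rewrite xc -[1]/(1%:~R) -intrD !gz TnS.
rewrite gE; last by rewrite cD intrD (inj_eq (addIr _)).
rewrite cD TnS [in RHS]gE // /cfrac_next cD intrD.
by congr (T (Tn _ (S (g _^-1)))); ring.
Qed.

Let ceil_next x c : ((c - 1)%:~R < x < c%:~R) -> g x = Tn c (S (g (c%:~R - x)^-1)).
Proof.
move=> /andP[lo hi]; have cE : Num.ceil x = c by apply: ceil_def; rewrite lo ltW.
by rewrite gE /cfrac_next cE // lt_eqF.
Qed.

Let g_gt1 x : 1 < x -> g (- x^-1) = S (g x).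
Proof.
move=> x1; rewrite (@ceil_next _ 0) ?Tn0 ?sub0r ?opprK ?invrK //.
rewrite oppr_lt0 invr_gt0 (lt_trans ltr01 x1) andbT.
by rewrite ?sub0r mulrN1z ltrN2 invf_lt1 // (lt_trans ltr01 x1).
Qed.

Let g1 : g 1 = Some 1.
Proof. by rewrite -[1]/(1%:~R) gz Tn1 /= mulr0 add0r. Qed.

Let gN1 : g (-1) = S (g 1).
Proof.
apply: T_inj; rewrite -gD1 addNr -[0]/(0%:~R) gz Tn0 g1 /= oner_eq0 /= mulr1.
by rewrite mulrN divff // addNr.
Qed.

Let g_pos z : 0 < z -> g z^-1 = S (g (- z)).
Proof.
move=> z0; have [n] : exists n : nat, z <= n%:R.
  by exists (Num.bound z); apply: ltW; apply: le_lt_trans (archi_boundP (ltW z0)); rewrite ?ler_norm.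
elim: n z z0 => [|n IHn] z z0 zn; first by move: z0; rewrite ltNge zn.
case: (ltgtP z 1) => [z1|z1|->]; last by rewrite invr1 gN1 SK.
  by have := @g_gt1 z^-1; rewrite invrK invf_gt1 // => -> //; rewrite SK.
have zm : 0 < z - 1 by rewrite subr_gt0.
have zu : z != 0 by rewrite lt0r_neq0.
have zmu : z - 1 != 0 by rewrite lt0r_neq0.
rewrite (@ceil_next _ 1); last first.
  by rewrite subrr invr_gt0 z0 invf_lt1.
rewrite Tn1; have -> : (1%:~R - z^-1)^-1 = (z - 1)^-1 + 1.
  by field; rewrite zu zmu.
rewrite gD1 IHn //; last by move: zn; rewrite -natr1; lra.
by have -> : - (z - 1) = - z + 1 by [ring]; rewrite gD1 braid.
Qed.

Lemma qrat_fun0 : qrat_fun (Some 0) = Some 0.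
Proof. by have := gz 0; rewrite Tn0. Qed.

Lemma qrat_funT x : qrat_fun (p1_affine 1 1 x) = T (qrat_fun x).
Proof. by case: x => [t|] //=; rewrite mul1r; apply: gD1. Qed.

Lemma qrat_funS x : qrat_fun (p1_neginv 1 x) = S (qrat_fun x).
Proof.
case: x => [t|]; last exact: qrat_fun0.
rewrite [p1_neginv _ _]/=; case: eqVneq => [->|t0].
  by rewrite qrat_fun0 /= eqxx.
rewrite mul1r -/(g _) -/(g _); case: (ltgtP t 0) t0 => // [tn|tp] _.
  by rewrite -invrN g_pos ?oppr_gt0 // opprK.
by have := @g_pos t^-1; rewrite invrK invr_gt0 => ->.
Qed.

Lemma qrat_fun_unique (f : P1 rat -> P1 K) :
    f (Some 0) = Some 0 ->
    (forall x, f (p1_affine 1 1 x) = T (f x)) ->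
    (forall x, f (p1_neginv 1 x) = S (f x)) ->
  f =1 qrat_fun.
Proof.
move=> f0 fT fS.
have fD1 t : f (Some (t + 1)) = T (f (Some t)) by rewrite -fT /= mul1r.
have fDn t (n : int) : f (Some (t + n%:~R)) = Tn n (f (Some t)).
  elim/int_rec: n => [|n IHn|n IHn]; first by rewrite addr0 Tn0.
    by rewrite -addn1 PoszD intrD addrA fD1 IHn TnS.
  apply: T_inj; rewrite -fD1 -TnS.
  have -> : - (n.+1%:Z) + 1 = - n%:Z by rewrite -addn1 PoszD opprD addrNK.
  by rewrite -IHn -addrA -[X in _ + X]/(_ + 1%:~R) -intrD -addn1 PoszD opprD addrNK.
have fE x : f (Some x) = g x.
  have [n] := ubnP `|denq x|%N; elim: n x => // n IHn x hx.
  case: (eqVneq x (Num.ceil x)%:~R) => [xc|xc].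
    by rewrite xc gz -f0 -fDn add0r.
  rewrite gE // -IHn //; last first.
    by apply: leq_trans (denq_next xc) _; rewrite -ltnS.
  rewrite -fS /p1_neginv invr_eq0 subr_eq0 eq_sym (negPf xc) -fDn mul1r invrK.
  by congr (f (Some _)); ring.
case=> [t|]; first exact: fE.
by have := fS (Some 0); rewrite f0 /= eqxx.
Qed.

End Construction.

Lemma qvar_neq0 : qvar != 0.
Proof. by rewrite tofrac_eq0 polyX_eq0. Qed.

Lemma qvar_neq1 : qvar - 1 != 0.
Proof. by rewrite -tofrac1 -tofracB tofrac_eq0 polyXsubC_eq0. Qed.

Lemma q_rational_exists : {f : P1 rat -> P1 Qq | is_q_rational f}.
Proof.
exists (qrat_fun qvar).
split.
- exact: qrat_fun0.
- exact: (qrat_funT qvar_neq0 qvar_neq1).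
- exact: (qrat_funS qvar_neq0 qvar_neq1).
Qed.

Lemma q_rational_unique f1 f2 :
  is_q_rational f1 -> is_q_rational f2 -> f1 =1 f2.
Proof.
move=> [a1 b1 c1] [a2 b2 c2] x.
rewrite (qrat_fun_unique qvar_neq0 qvar_neq1 a1 b1 c1).
by rewrite (qrat_fun_unique qvar_neq0 qvar_neq1 a2 b2 c2).
Qed.

(* the unique map satisfying [is_q_rational], by [q_rational_unique] *)
Definition q_rational : P1 rat -> P1 Qq := sval q_rational_exists.

Lemma q_rationalP : is_q_rational q_rational.
Proof. exact: svalP. Qed.

Definition cross_ratio_q (x1 x2 x3 x4 : P1 rat) : Qq :=
  cross_ratio (q_rational x1) (q_rational x2) (q_rational x3) (q_rational x4).

(* Value at a real t of a rational function, computed on its reduced fraction: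
   an arbitrary representative may have a removable singularity at t. *)
Definition ratfun_eval (R : realType) (f : Qq) (t : R) : R :=
  let n := (frac (repr f)).1 in
  let d := (frac (repr f)).2 in
  (map_poly ratr (n %/ gcdp n d)).[t] / (map_poly ratr (d %/ gcdp n d)).[t].

Lemma ratfun_evalE (R : realType) (n d : {poly rat}) (t : R) :
    (map_poly ratr d).[t] != 0 ->
  ratfun_eval (n%:F / d%:F) t = (map_poly ratr n).[t] / (map_poly ratr d).[t].
Proof.
move=> dt; rewrite /ratfun_eval; set f := n%:F / d%:F.
set N := (frac (repr f)).1; set D := (frac (repr f)).2; set G := gcdp N D.
have D0 : D != 0 by apply: denom_ratioP.
have d0 : d != 0 by apply: contraNneq dt => ->; rewrite rmorph0 horner0.
have fE : f = N%:F / D%:F.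
  rewrite -[LHS]reprK /N /D; move: (repr f) => z.
  unlock FracField.tofrac; rewrite -[X in _ * X]FracField.pi_inv.
  rewrite -[RHS]FracField.pi_mul /FracField.mulf /FracField.invf.
  by rewrite !numden_Ratio ?oner_neq0 ?denom_ratioP // mulr1 mul1r Ratio_numden.
have G0 : G != 0 by rewrite gcdp_eq0 negb_and D0 orbT.
have ND : n * D = N * d.
  apply/eqP; rewrite -tofrac_eq !rmorphM /= -eqr_div ?tofrac_eq0 //.
  by apply/eqP; rewrite -fE.
have nd : n * (D %/ G) = (N %/ G) * d.
  apply: (mulIf G0); rewrite -mulrA divpK ?dvdp_gcdr // ND mulrAC divpK //.
  exact: dvdp_gcdl.
have cop : coprimep (D %/ G) (N %/ G).
  by rewrite coprimep_sym coprimep_div_gcd // D0 orbT.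
have : D %/ G %| d.
  by rewrite -(Gauss_dvdpr _ cop) -nd dvdp_mull.
case/dvdpP => e dE.
have Dt : (map_poly ratr (D %/ G)).[t] != 0.
  by apply: contraNneq dt => h; rewrite dE rmorphM hornerM /= h mulr0.
apply/eqP; rewrite eqr_div //.
by rewrite -!hornerM -!rmorphM /= nd.
Qed.

(* With cr_{e^h} = cr + cr' h + cr''/2 h^2 + ..., cr'' is the second derivative
   of h |-> cr_{e^h} at h = 0. *)
Definition cross_ratio2 (R : realType) (x1 x2 x3 x4 : P1 rat) : R :=
  derive1n 2 (fun h : R => ratfun_eval (cross_ratio_q x1 x2 x3 x4) (expR h)) 0.

(* Main.v *)
(* The shear x |-> x + 1/2 has determinant 1 and maps the normalized lifts of
   (oo, 3/4, 5/4, 1/4) to those of (oo, 5/4, 7/4, 3/4), so it preserves all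
   Pluecker determinants. It is not in PSL_2(Z), though, and the q-cross-ratios
   of the two quadruples differ: they are -(q + q^2) / (1 + q^4) and
   -(1 + q^4) / (q^2 + q^3), with cr'' equal to 7/2 and -4. *)
Require Import Defs.
From mathcomp Require Import all_boot all_order all_algebra.
From mathcomp Require Import all_classical all_reals all_analysis.
From mathcomp Require Import ring lra.

Import Order.TTheory GRing.Theory Num.Theory.
Import numFieldNormedType.Exports.

Local Open Scope ring_scope.

Local Notation "p %:F" := (@FracField.tofrac _ p).

Section DerivativeAlongExponential.
Variable R : realType.
Implicit Types (n d p : {poly R}) (h : R).

Lemma is_derive_horner_expR p h :
  is_derive h (1 : R) (fun x => p.[expR x]) ('X * deriv p).[expR h].
Proof.
have := @is_derive1_comp R (horner p) expR h _ _ (is_derive_poly p _)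
  (is_derive_expR h).
by rewrite hornerM hornerX mulrC.
Qed.

Lemma derive1_quotient_expR n d : (forall h, d.[expR h] != 0) ->
  derive1 (fun h => n.[expR h] / d.[expR h]) =
  (fun h => ('X * (deriv n * d - n * deriv d)).[expR h] / (d ^+ 2).[expR h]).
Proof.
move=> d0; apply/funext => h; rewrite derive1E.
have dn := is_derive_horner_expR n h.
have dV := @is_deriveV _ (fun x => d.[expR x]) h _ 1 (d0 h)
  (is_derive_horner_expR d h).
have [_ ->] := is_deriveM dn dV.
rewrite /GRing.scale /= !(hornerM, hornerD, hornerN, hornerX); field; exact: d0.
Qed.

End DerivativeAlongExponential.

Lemma derive2_ratfun_eval_expR (R : realType) (n d : {poly rat}) :
    (forall t : R, 0 < t -> (map_poly ratr d).[t] != 0) ->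
    let N : {poly R} := map_poly ratr n in
    let D : {poly R} := map_poly ratr d in
    let w := (deriv N).[1] * D.[1] - N.[1] * (deriv D).[1] in
    let w' := (deriv (deriv N)).[1] * D.[1] - N.[1] * (deriv (deriv D)).[1] in
  derive1n 2 (fun h : R => ratfun_eval (n%:F / d%:F) (expR h)) 0 =
    (w + w') / D.[1] ^+ 2 - 2%:R * w * (deriv D).[1] / D.[1] ^+ 3.
Proof.
move=> d0 N D w w'.
have D0 h : D.[expR h] != 0 by apply/d0/expR_gt0.
have D1 : D.[1] != 0 by rewrite -expR0.
have -> : (fun h : R => ratfun_eval (n%:F / d%:F) (expR h))
    = fun h => N.[expR h] / D.[expR h].
  by apply/funext => h; rewrite ratfun_evalE.
rewrite /derive1n /= derive1_quotient_expR // derive1_quotient_expR; last first.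
  by move=> h; rewrite horner_exp expf_neq0.
rewrite expR0 expr2 !(derivM, derivD, derivN, derivX).
rewrite !(hornerM, hornerD, hornerN, hornerX, hornerC) /w /w'.
move: D1; move: (N.[1]) (D.[1]) => a b b0.
move: (deriv N).[1] (deriv D).[1] => a1 b1.
move: (deriv (deriv N)).[1] (deriv (deriv D)).[1] => a2 b2.
by field.
Qed.

Section QRationals.
Variables (K : fieldType) (q : K) (f : P1 rat -> P1 K).
Hypothesis q0 : q != 0.
Hypothesis f0 : f (Some 0) = Some 0.
Hypothesis fT : forall x, f (p1_affine 1 1 x) = p1_affine q 1 (f x).
Hypothesis fS : forall x, f (p1_neginv 1 x) = p1_neginv q (f x).

Definition qint (n : nat) : K := \sum_(i < n) q ^+ i.

Lemma qrat_infty : f None = None.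
Proof. by have := fS (Some 0); rewrite f0 /= eqxx. Qed.

Lemma qratD1 x t : f (Some x) = Some t -> f (Some (x + 1)) = Some (q * t + 1).
Proof. by have /= := fT (Some x); rewrite mul1r => -> ->. Qed.

Lemma qratB1 x t : f (Some x) = Some t -> f (Some (x - 1)) = Some ((t - 1) / q).
Proof.
have /= := fT (Some (x - 1)); rewrite mul1r subrK => ->.
by case: (f _) => //= u [<-]; rewrite addrK mulrC mulKf.
Qed.

Lemma qratNV x t : x != 0 -> t != 0 -> f (Some x) = Some t ->
  f (Some (- x^-1)) = Some (- (q * t)^-1).
Proof.
move=> /negPf x0 /negPf t0 xt.
by have /= := fS (Some x); rewrite x0 xt /= t0 mul1r.
Qed.

Lemma qrat_nat n : f (Some n%:R) = Some (qint n).
Proof.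
elim: n => [|n /qratD1]; first by rewrite /qint big_ord0.
rewrite natr1 => ->; congr Some.
rewrite /qint big_ord_recl expr0 addrC big_distrr /=; congr (_ + _).
by apply: eq_bigr => i _; rewrite exprS.
Qed.

Lemma qrat_oppnat n : f (Some (- n%:R)) = Some (- (qint n / q ^+ n)).
Proof.
elim: n => [|n /qratB1]; first by rewrite /qint big_ord0 mul0r !oppr0.
rewrite -opprD natr1 => ->; congr Some.
by rewrite /qint big_ord_recr exprS /=; field; rewrite q0 expf_neq0.
Qed.

Lemma qrat_invn n : qint n.+1 != 0 ->
  f (Some n.+1%:R^-1) = Some (q ^+ n / qint n.+1).
Proof.
move=> s0; have := qratNV _ _ _ _ (qrat_oppnat n.+1).
rewrite invrN opprK => ->; first congr Some.
- by rewrite exprS; field; rewrite q0 s0 expf_neq0 ?oppr_eq0 ?s0.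
- by rewrite oppr_eq0 pnatr_eq0.
- by rewrite oppr_eq0 mulf_neq0 ?invr_neq0 ?expf_neq0.
Qed.

Lemma qrat_oneBinvn n : qint n.+1 != 0 ->
  f (Some (1 - n.+1%:R^-1)) = Some (1 - (qint n.+1)^-1).
Proof.
move=> s0; have n0 : n.+1%:R != 0 :> rat by rewrite pnatr_eq0.
have := qratD1 _ _ (qratNV _ _ n0 s0 (qrat_nat n.+1)).
by rewrite addrC => ->; congr Some; field; rewrite q0 s0.
Qed.

Lemma cross_ratio_qrat_infty x2 x3 x4 t2 t3 t4 :
    f (Some x2) = Some t2 -> f (Some x3) = Some t3 -> f (Some x4) = Some t4 ->
  cross_ratio (f None) (f (Some x2)) (f (Some x3)) (f (Some x4))
    = (t2 - t4) / (t2 - t3).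
Proof.
move=> -> -> ->; rewrite qrat_infty.
by rewrite /cross_ratio /det2 /= !mulr1 !mulr0 !subr0 !mul1r.
Qed.

Hypothesis qint4_neq0 : qint 4 != 0.

Lemma qint4 : qint 4 = 1 + q + q ^+ 2 + q ^+ 3.
Proof. by rewrite /qint !big_ord_recr big_ord0 /= add0r expr0 expr1. Qed.

Lemma qrat_1_4 : f (Some (1 / 4%:R)) = Some (q ^+ 3 / qint 4).
Proof. by rewrite -qrat_invn // div1r. Qed.

Lemma qrat_3_4 : f (Some (3%:R / 4%:R)) = Some (1 - (qint 4)^-1).
Proof. by rewrite -qrat_oneBinvn //; congr (f (Some _)); field. Qed.

Lemma qrat_5_4 : f (Some (5%:R / 4%:R)) = Some (q * (q ^+ 3 / qint 4) + 1).
Proof. by rewrite -(qratD1 _ _ qrat_1_4); congr (f (Some _)); field. Qed.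

Lemma qrat_7_4 : f (Some (7%:R / 4%:R)) = Some (q * (1 - (qint 4)^-1) + 1).
Proof. by rewrite -(qratD1 _ _ qrat_3_4); congr (f (Some _)); field. Qed.

Lemma cross_ratio_qrat_3_5_1 : 1 + q ^+ 4 != 0 ->
  cross_ratio (f None) (f (Some (3%:R / 4%:R))) (f (Some (5%:R / 4%:R)))
    (f (Some (1 / 4%:R))) = - (q + q ^+ 2) / (1 + q ^+ 4).
Proof.
move=> d0.
rewrite (cross_ratio_qrat_infty _ _ _ _ _ _ qrat_3_4 qrat_5_4 qrat_1_4).
have -> : 1 - (qint 4)^-1 - q ^+ 3 / qint 4 = (q + q ^+ 2) / qint 4.
  by move: qint4_neq0; rewrite qint4 => s0; field.
have -> : 1 - (qint 4)^-1 - (q * (q ^+ 3 / qint 4) + 1)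
    = - ((1 + q ^+ 4) / qint 4) by field.
by field; rewrite oppr_eq0 qint4_neq0 d0.
Qed.

Lemma cross_ratio_qrat_5_7_3 : q ^+ 2 + q ^+ 3 != 0 ->
  cross_ratio (f None) (f (Some (5%:R / 4%:R))) (f (Some (7%:R / 4%:R)))
    (f (Some (3%:R / 4%:R))) = - (1 + q ^+ 4) / (q ^+ 2 + q ^+ 3).
Proof.
move=> d0.
rewrite (cross_ratio_qrat_infty _ _ _ _ _ _ qrat_5_4 qrat_7_4 qrat_3_4).
have -> : q * (q ^+ 3 / qint 4) + 1 - (1 - (qint 4)^-1)
    = (1 + q ^+ 4) / qint 4 by field.
have -> : q * (q ^+ 3 / qint 4) + 1 - (q * (1 - (qint 4)^-1) + 1)
    = - ((q ^+ 2 + q ^+ 3) / qint 4).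
  by move: qint4_neq0; rewrite qint4 => s0; field.
by field; rewrite oppr_eq0 qint4_neq0 d0.
Qed.

End QRationals.

Lemma tofrac_neq0_at1 (p : {poly rat}) : p.[1] != 0 -> p%:F != 0.
Proof.
by apply: contraNneq => /eqP; rewrite tofrac_eq0 => /eqP ->; rewrite horner0.
Qed.

Lemma qint4_qvar_neq0 : qint _ qvar 4 != 0.
Proof.
have := @tofrac_neq0_at1 (1 + 'X + 'X^2 + 'X^3).
by rewrite qint4 !rmorphD !rmorphXn rmorph1 !hornerE; apply.
Qed.

Lemma cross_ratio_q_3_5_1 :
  cross_ratio_q None (Some (3%:R / 4%:R)) (Some (5%:R / 4%:R)) (Some (1 / 4%:R))
  = (- ('X + 'X^2))%:F / (1 + 'X^4)%:F.
Proof.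
have [f0 fT fS] := q_rationalP.
have := @tofrac_neq0_at1 (1 + 'X^4).
rewrite !hornerE rmorphN !rmorphD !rmorphXn rmorph1 => /(_ isT) d0.
exact: (cross_ratio_qrat_3_5_1 _ _ _ qvar_neq0 f0 fT fS qint4_qvar_neq0 d0).
Qed.

Lemma cross_ratio_q_5_7_3 :
  cross_ratio_q None (Some (5%:R / 4%:R)) (Some (7%:R / 4%:R)) (Some (3%:R / 4%:R))
  = (- (1 + 'X^4))%:F / ('X^2 + 'X^3)%:F.
Proof.
have [f0 fT fS] := q_rationalP.
have := @tofrac_neq0_at1 ('X^2 + 'X^3).
rewrite !hornerE rmorphN !rmorphD !rmorphXn rmorph1 => /(_ isT) d0.
exact: (cross_ratio_qrat_5_7_3 _ _ _ qvar_neq0 f0 fT fS qint4_qvar_neq0 d0).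
Qed.

Lemma cross_ratio2_3_5_1 (R : realType) :
  cross_ratio2 R None (Some (3%:R / 4%:R)) (Some (5%:R / 4%:R)) (Some (1 / 4%:R))
  = 7%:R / 2%:R.
Proof.
rewrite /cross_ratio2 cross_ratio_q_3_5_1 derive2_ratfun_eval_expR.
  rewrite rmorphN !rmorphD rmorph1 /= map_polyX !map_polyXn.
  rewrite !(derivD, derivN, derivC, derivX, derivXn, derivMn) /=.
  rewrite !(hornerD, hornerN, hornerMn, hornerXn, hornerX, hornerC) !expr1n.
  by field.
move=> t t0; rewrite rmorphD rmorph1 /= map_polyXn hornerD hornerC hornerXn.
by rewrite lt0r_neq0 // ltr_wpDr // exprn_ge0 // ltW.
Qed.

Lemma cross_ratio2_5_7_3 (R : realType) :
  cross_ratio2 R None (Some (5%:R / 4%:R)) (Some (7%:R / 4%:R)) (Some (3%:R / 4%:R))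
  = - 4%:R.
Proof.
rewrite /cross_ratio2 cross_ratio_q_5_7_3 derive2_ratfun_eval_expR.
  rewrite rmorphN !rmorphD rmorph1 /= !map_polyXn.
  rewrite !(derivD, derivN, derivC, derivX, derivXn, derivMn) /=.
  rewrite !(hornerD, hornerN, hornerMn, hornerXn, hornerX, hornerC) !expr1n.
  by field.
move=> t t0; rewrite rmorphD /= !map_polyXn hornerD !hornerXn.
by rewrite lt0r_neq0 // addr_gt0 // exprn_gt0.
Qed.

Theorem proposition1p6 (R : realType) :
  ~ exists F : int -> int -> int -> int -> int -> int -> R,
      forall x1 x2 x3 x4 : P1 rat, uniq [:: x1; x2; x3; x4] ->
        cross_ratio2 R x1 x2 x3 x4 =
          F (Delta x1 x2) (Delta x1 x3) (Delta x1 x4)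
            (Delta x2 x3) (Delta x2 x4) (Delta x3 x4).
Proof.
move=> [F HF]; suff: (7%:R / 2%:R : R) = - 4%:R by lra.
by rewrite -cross_ratio2_3_5_1 -cross_ratio2_5_7_3 !HF.
Qed.
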